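(* Let $\varepsilon>0$ and put $\delta_1=2\big(\sqrt{2\varepsilon}+7\varepsilon+2\sqrt2\,\varepsilon^{3/2}+3\varepsilon^2\big)$ and $\delta_2=2\varepsilon+\varepsilon^2$. If $8\delta_1+\delta_2<\frac12$, then any port based teleportation scheme with error $\varepsilon$ for teleporting a $d$-dimensional state uses at least $$ N\ \ge\ \frac12\left(\log\Big(\frac1{4\delta_1+\delta_2}\Big)-1\right) $$ output ports.
   Context: $\log$ is base 2. All Hilbert spaces are finite-dimensional. An $N$-port port based teleportation (PBT) protocol for a $d$-dimensional system is given by a resource state $\rho_{A'B_1\cdots B_N}$ ($\mathcal H_{A'}$ arbitrary, each $\mathcal H_{B_i}\cong\mathcal H_B\cong\mathbb C^d$) and an $N$-outcome POVM $\{(E_i)_{A_0A'}\}_{i=1}^N$ on $\mathcal H_{A_0}\otimes\mathcal H_{A'}$, with input register $\mathcal H_{A_0}\cong\mathbb C^d$. The resulting channel is $$\Lambda_{A_0\to B}(X)=\sum_{i=1}^N\mathrm{tr}_{A_0A'B_{i^c}}\big[(E_i)_{A_0A'}(X_{A_0}\otimes\rho_{A'B^N})\big],$$ where $B_{i^c}$ denotes all ports except $B_i$ and $B_i$ is renamed $B$ in each summand. The protocol has error $\varepsilon$ if $\|\Lambda_{A_0\to B}-\mathrm{id}_{A_0\to B}\|_\diamond\le\varepsilon$, where $\|\Lambda\|_\diamond=\sup_{\rho_{AE}}\|(\Lambda\otimes\mathrm{id}_E)(\rho_{AE})\|_1$ over all auxiliary systems $E$ and states $\rho_{AE}$.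
   Formalization: The formal statement assumes the dimension d is at least 2; for d = 1 a one-port scheme has zero error, so the claimed lower bound on N fails for small ε. *)

(* Defs.v *)
From HB Require Import structures.
From mathcomp Require Import all_boot all_order all_algebra.
From mathcomp Require Import spectral.
From mathcomp Require Import complex.
From mathcomp Require Import all_classical all_reals.
From mathcomp Require Import ereal exp.

Set Implicit Arguments.
Unset Strict Implicit.
Unset Printing Implicit Defensive.

Import Order.TTheory GRing.Theory Num.Theory.

Local Open Scope ring_scope.
Local Open Scope complex_scope.
Local Open Scope sesquilinear_scope.

(* A finite-dimensional Hilbert space is given by a finite type S labelling an
   orthonormal basis, so that S * T labels the product basis of a tensor
   product.  Its operators are the complex matrices with rows and columns
   enumerated by S. *)
Notation "''Op[' R ]_ S" := 'M[R[i]]_#|{: S}|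
  (at level 8, S at level 2, format "''Op[' R ]_ S").

Section Operators.
Variable R : realType.
Implicit Types S T U E : finType.

Definition opfun S (f : S -> S -> R[i]) : 'Op[R]_S :=
  \matrix_(i, j) f (enum_val i) (enum_val j).

Definition opentry S (A : 'Op[R]_S) (x y : S) : R[i] :=
  A (enum_rank x) (enum_rank y).

Lemma opfunE S (f : S -> S -> R[i]) x y : opentry (opfun f) x y = f x y.
Proof. by rewrite /opentry mxE !enum_rankK. Qed.

Definition ketbra S (x y : S) : 'Op[R]_S :=
  delta_mx (enum_rank x) (enum_rank y).

Definition optens S T (A : 'Op[R]_S) (B : 'Op[R]_T) : 'Op[R]_(S * T)%type :=
  opfun (fun x y => opentry A x.1 y.1 * opentry B x.2 y.2).

Definition opassoc S T U (A : 'Op[R]_(S * (T * U))%type) :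
    'Op[R]_((S * T) * U)%type :=
  opfun (fun x y =>
    opentry A (x.1.1, (x.1.2, x.2)) (y.1.1, (y.1.2, y.2))).

Definition ptrace1 S T (A : 'Op[R]_(S * T)%type) : 'Op[R]_T :=
  opfun (fun x y => \sum_(s : S) opentry A (s, x) (s, y)).

(* The trace over all the tensor factors of S^(x)N except the i-th one. *)
Definition ptrace_but S (N : nat) (i : 'I_N)
    (A : 'Op[R]_{ffun 'I_N -> S}) : 'Op[R]_S :=
  opfun (fun x y => \sum_(f : {ffun 'I_N -> S} | f i == x)
    opentry A f [ffun j => if j == i then y else f j]).

(* On R[i], 0 <= z means that z is real and nonnegative. *)
Definition psdmx n (A : 'M[R[i]]_n) : Prop :=
  forall v : 'cV[R[i]]_n, 0 <= (v^t* *m A *m v) 0 0.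

Definition state n (A : 'M[R[i]]_n) : Prop := psdmx A /\ \tr A = 1.

(* The square root given by functional calculus; meant for psd A. *)
Definition sqrtmx n (A : 'M[R[i]]_n) : 'M[R[i]]_n :=
  invmx (spectralmx A) *m diag_mx (map_mx sqrtC (spectral_diag A))
    *m spectralmx A.

Lemma sqrtmxK n (A : 'M[R[i]]_n) :
  A \is normalmx -> sqrtmx A *m sqrtmx A = A.
Proof.
move=> /orthomx_spectralP AE; rewrite [RHS]AE /sqrtmx !mulmxA.
rewrite mulmxK ?spectral_unit // -(mulmxA _ (diag_mx _) (diag_mx _)) mulmx_diag.
congr (_ *m diag_mx _ *m _); apply/rowP => j.
by rewrite !mxE -expr2 sqrtCK.
Qed.

Definition trace_norm n (A : 'M[R[i]]_n) : R :=
  complex.Re (\tr (sqrtmx (A^t* *m A))).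

Definition opblock S E (A : 'Op[R]_(S * E)%type) (e e' : E) : 'Op[R]_S :=
  opfun (fun x y => opentry A (x, e) (y, e')).

(* (L (x) id_E)(A), using A = \sum_(e, e') (opblock A e e') (x) |e><e'|. *)
Definition ampliation S T (L : {linear 'Op[R]_S -> 'Op[R]_T}) E
    (A : 'Op[R]_(S * E)%type) : 'Op[R]_(T * E)%type :=
  \sum_(e : E) \sum_(e' : E) optens (L (opblock A e e')) (ketbra e e').

Definition diamond_norm S T (L : {linear 'Op[R]_S -> 'Op[R]_T}) : \bar R :=
  ereal_sup [set x | exists (E : finType) (rho : 'Op[R]_(S * E)%type),
    state rho /\ x = (trace_norm (ampliation L rho))%:E]%classic.

End Operators.

Record pbt (R : realType) (d N : nat) := Pbt {
  pbt_anc : finType;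
  pbt_res : 'Op[R]_(pbt_anc * {ffun 'I_N -> 'I_d})%type;
  pbt_povm : 'I_N -> 'Op[R]_('I_d * pbt_anc)%type;
  pbt_res_state : state pbt_res;
  pbt_povm_psd : forall i, psdmx (pbt_povm i);
  pbt_povm_sum : \sum_(i < N) pbt_povm i = 1%:M }.

Section Channel.
Variables (R : realType) (d N : nat) (P : pbt R d N).

Definition pbt_channel (X : 'Op[R]_'I_d) : 'Op[R]_'I_d :=
  \sum_(i < N) ptrace_but i (ptrace1
    (optens (pbt_povm P i) 1%:M *m opassoc (optens X (pbt_res P)))).

Lemma opfun_linear (S : finType) (f g h : S -> S -> R[i]) (a : R[i]) :
  (forall x y, h x y = a * f x y + g x y) ->
  opfun h = a *: opfun f + opfun g.
Proof. by move=> hE; apply/matrixP => i j; rewrite !mxE hE. Qed.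

Lemma opentry_linear (S : finType) (A B : 'Op[R]_S) (a : R[i]) x y :
  opentry (a *: A + B) x y = a * opentry A x y + opentry B x y.
Proof. by rewrite /opentry !mxE. Qed.

Fact pbt_channel_linear : linear pbt_channel.
Proof.
move=> a X Y; rewrite /pbt_channel scaler_sumr -big_split; apply: eq_bigr => i _.
have -> : opassoc (optens (a *: X + Y) (pbt_res P)) =
    a *: opassoc (optens X (pbt_res P)) + opassoc (optens Y (pbt_res P)).
  apply: opfun_linear => x y.
  by rewrite !opfunE opentry_linear mulrDl mulrA.
rewrite mulmxDr -scalemxAr.
set A := _ *m _; set B := _ *m _.
have -> : ptrace1 (a *: A + B) = a *: ptrace1 A + ptrace1 B.
  apply: opfun_linear => x y.
  rewrite mulr_sumr -big_split; apply: eq_bigr => s _.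
  exact: opentry_linear.
apply: opfun_linear => x y.
rewrite mulr_sumr -big_split; apply: eq_bigr => f _.
exact: opentry_linear.
Qed.

HB.instance Definition _ :=
  GRing.isLinear.Build R[i] 'Op[R]_'I_d 'Op[R]_'I_d _ pbt_channel
    pbt_channel_linear.

Definition pbt_error (eps : R) : Prop :=
  (diamond_norm ((pbt_channel \- idfun)%R : {linear 'Op[R]_'I_d -> 'Op[R]_'I_d})
     <= eps%:E)%E.

End Channel.

Definition log2 (R : realType) (x : R) : R := ln x / ln 2.

(* Main.v *)
(** Port teleportation only relabels a port: for x <> y, the entry z of
    Lambda(|x><y|) at (x, y) is the sum over i and over the port strings f with
    f i = x of G_i((x, f), (y, f[i := y])), where each G_i is a Gram kernel and,
    the POVM being complete, sum_i G_i((x, f), (x, f)) = r f does not depend on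
    x, with r a probability distribution on port strings.  Each such step raises
    the number k of ports holding y by one, so a weighted AM-GM inequality with
    weight s (k + 1) / s k, for the concave s k = (k + 1)(N + 1 - k), gives
    Re z <= 1 - 1 / (N + 1)^2.  The identity channel has z = 1, and testing on
    (|xx> + |yy>) / sqrt 2 yields eps >= 1 / (2 (N + 1)^2), which is stronger
    than the exponentially small bound on eps that the theorem asks for. *)

Require Import Defs.
From mathcomp Require Import all_boot all_order all_algebra.
From mathcomp Require Import spectral complex.
From mathcomp Require Import all_classical all_reals.
From mathcomp Require Import ereal exp.
From mathcomp Require Import ring lra zify.

Import Order.TTheory GRing.Theory Num.Theory.
Local Open Scope ring_scope.

(** * Positive semidefinite matrices as Gram matrices *)

Section Gram.
Set Implicit Arguments.
Unset Strict Implicit.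
Variable C : numClosedFieldType.
Local Open Scope sesquilinear_scope.

Lemma psd_diag_unitary n (U A : 'M[C]_n) (D : 'rV[C]_n) :
    U \is unitarymx -> A = invmx U *m diag_mx D *m U ->
    (forall v : 'cV[C]_n, 0 <= (v^t* *m A *m v) 0 0) ->
  forall j, 0 <= D 0 j.
Proof.
move=> Uu AE Apsd j; have := Apsd (U^t* *m delta_mx j 0).
rewrite AE invmx_unitary //.
have -> : (U^t* *m delta_mx j (0 : 'I_1))^t* = delta_mx 0 j *m U.
  rewrite trmx_mul map_mxM /= trmx_delta map_delta_mx; congr (_ *m _).
  exact: trmxCK.
have UU : U *m U^t* = 1%:M by apply/unitarymxP.
rewrite !mulmxA -(mulmxA _ U (U^t*)) UU mulmx1.
rewrite -(mulmxA _ U (U^t*)) UU mulmx1.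
by rewrite -rowE -colE !mxE eqxx mulr1n.
Qed.

(** Polarization: the form is real at e_i, e_j, e_i + e_j and e_i + 'i e_j, so [A i j + A j i] and
    ['i * (A i j - A j i)] are real, which determines the conjugate of [A i j]. *)
Lemma psd_hermitian n (A : 'M[C]_n) :
    (forall v : 'cV[C]_n, 0 <= (v^t* *m A *m v) 0 0) ->
  forall i j, A j i = (A i j)^*.
Proof.
move=> Apsd i j.
have AE (a b : C) : (A i i * (a^* * a) + A i j * (a^* * b)
    + A j i * (b^* * a) + A j j * (b^* * b)) \is Num.real.
  apply: ger0_real; have := Apsd (a *: delta_mx i 0 + b *: delta_mx j 0).
  have -> : (a *: delta_mx i (0 : 'I_1) + b *: delta_mx j 0)^t* =
      a^* *: delta_mx 0 i + b^* *: delta_mx 0 j.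
    by apply/matrixP => k l; rewrite !mxE rmorphD !rmorphM !rmorph_nat !(andbC (l == _)).
  rewrite !(mulmxDl, mulmxDr) -!scalemxAl -!scalemxAr.
  rewrite -!rowE -!colE !mxE => h.
  by apply: le_trans h _; rewrite le_eqVlt; apply/orP; left; apply/eqP; ring.
have Aii : A i i \is Num.real.
  by have := AE 1 0; rewrite !conjC0 conjC1 !(mulr0, mul0r, mulr1, addr0).
have Ajj : A j j \is Num.real.
  by have := AE 0 1; rewrite !conjC0 conjC1 !(mulr0, mul0r, mulr1, addr0, add0r).
have h1 : A i j + A j i \is Num.real.
  have := AE 1 1; rewrite conjC1 !mulr1 => h.
  have -> : A i j + A j i = A i i + A i j + A j i + A j j - (A i i + A j j).
    by ring.
  by rewrite realB // realD.
have h2 : 'i * (A i j - A j i) \is Num.real.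
  have := AE 1 'i; rewrite conjC1 conjCi !(mul1r, mulr1) mulNr -expr2 sqrCi.
  rewrite opprK mulr1 => h.
  have -> : 'i * (A i j - A j i) = A i i + A i j * 'i + A j i * - 'i + A j j
      - (A i i + A j j) by ring.
  by rewrite realB // realD.
move/CrealP: h1; move/CrealP: h2; rewrite rmorphM !rmorphD rmorphN /= conjCi => h2 h1.
have h3 : (A i j)^* - (A j i)^* = A j i - A i j.
  apply: (mulfI (neq0Ci C)); apply: oppr_inj.
  by rewrite -!mulNr h2; ring.
apply: (mulfI (_ : 2%:R != 0 :> C)); first by rewrite pnatr_eq0.
transitivity ((A i j)^* + (A j i)^* + ((A i j)^* - (A j i)^*)); last by ring.
by rewrite h1 h3; ring.
Qed.

Lemma psd_gram n (A : 'M[C]_n) :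
    (forall v : 'cV[C]_n, 0 <= (v^t* *m A *m v) 0 0) ->
  exists B : 'M[C]_n, A = B^t* *m B.
Proof.
move=> Apsd; have An : A \is normalmx.
  apply/normalmxP; suff -> : A^t* = A by [].
  by apply/matrixP => i j; rewrite !mxE (psd_hermitian Apsd) conjCK.
have /orthomx_spectralP := An.
set U := spectralmx A; set D := spectral_diag A => AE.
have Uu : U \is unitarymx by exact: spectral_unitarymx.
have D0 := psd_diag_unitary Uu AE Apsd.
(* With A = U^* D U and D nonnegative, B = D^(1/2) U. *)
exists (diag_mx (map_mx sqrtC D) *m U).
rewrite [LHS]AE trmx_mul map_mxM tr_diag_mx invmx_unitary //.
rewrite !mulmxA; congr (_ *m _); rewrite -!mulmxA; congr (_ *m _).
rewrite map_diag_mx mulmx_diag; congr diag_mx; apply/rowP => j.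
by rewrite !mxE /= geC0_conj ?sqrtC_ge0 // -expr2 sqrtCK.
Qed.

End Gram.

(** * Matrix entries against the trace norm *)

Section TraceNorm.
Set Implicit Arguments.
Unset Strict Implicit.
Variable R : realType.
Local Open Scope sesquilinear_scope.
Local Open Scope complex_scope.
(* Reopened so that x^* is Num.conj and not the conjc of complex_scope. *)
Local Open Scope ring_scope.

Lemma adjoint_mul_psd m n (A : 'M[R[i]]_(m, n)) (v : 'cV[R[i]]_n) :
  0 <= (v^t* *m (A^t* *m A) *m v) 0 0.
Proof.
have -> : v^t* *m (A^t* *m A) *m v = (A *m v)^t* *m (A *m v).
  by rewrite trmx_mul map_mxM !mulmxA.
by rewrite mxE sumr_ge0 // => j _; rewrite !mxE mulrC mul_conjC_ge0.
Qed.

(** The square of the left side is one term of tr(A^* A). That trace is the sum of the squared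
    singular values, hence at most the square of their sum. *)
Lemma norm_entry_le_trace_norm n (A : 'M[R[i]]_n) p q :
  `|A p q| <= (trace_norm A)%:C.
Proof.
set M := A^t* *m A; have Mn : M \is normalmx.
  apply/normalmxP; suff -> : M^t* = M by [].
  by rewrite trmx_mul map_mxM trmxCK.
have /orthomx_spectralP := Mn => ME.
have Uu := spectral_unitarymx M.
have D0 := psd_diag_unitary Uu ME (adjoint_mul_psd A).
set T := \sum_j sqrtC (spectral_diag M 0 j).
have T0 : 0 <= T by apply: sumr_ge0 => j _; rewrite sqrtC_ge0.
have TE : (trace_norm A)%:C = T.
  rewrite /trace_norm -/M /sqrtmx -mulmxA mxtrace_mulC mulmxK ?spectral_unit //.
  rewrite mxtrace_diag (eq_bigr (fun j => sqrtC (spectral_diag M 0 j))).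
    by rewrite -/T; apply: RRe_real; exact: ger0_real.
  by move=> j _; rewrite mxE.
rewrite TE -(@ler_pXn2r _ 2) ?nnegrE //.
have trM : \tr M = \sum_j spectral_diag M 0 j.
  rewrite [in LHS]ME -mulmxA mxtrace_mulC mulmxK ?spectral_unit //.
  by rewrite mxtrace_diag.
have trMT : \tr M <= T ^+ 2.
  rewrite trM expr2 mulr_suml; apply: ler_sum => j _.
  rewrite -[leLHS]sqrtCK expr2 ler_wpM2l ?sqrtC_ge0 // /T (bigD1 j) //=.
  by rewrite lerDl sumr_ge0 // => k _; rewrite sqrtC_ge0.
apply: le_trans trMT; rewrite /mxtrace (bigD1 q) //= mxE (bigD1 p) //= !mxE.
rewrite -normCKC -addrA lerDl addr_ge0 // sumr_ge0 // => k _.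
  by rewrite !mxE mulrC mul_conjC_ge0.
by rewrite mxE sumr_ge0 // => l _; rewrite !mxE mulrC mul_conjC_ge0.
Qed.

End TraceNorm.

(** * Weighted AM-GM over port strings *)

Section PortSum.
Set Implicit Arguments.
Unset Strict Implicit.
Variables (C : numFieldType) (S : finType) (N : nat).
Local Notation F := {ffun 'I_N -> S}.

Definition set_port (f : F) (i : 'I_N) (y : S) : F :=
  [ffun j => if j == i then y else f j].

Definition port_count (y : S) (f : F) : nat := #|[set j | f j == y]|.

Lemma port_count_le y (f : F) : (port_count y f <= N)%N.
Proof. by apply: leq_trans (max_card _) _; rewrite card_ord. Qed.

Lemma port_count_set (f : F) i y :
  f i != y -> port_count y (set_port f i y) = (port_count y f).+1.
Proof.
move=> fiy; rewrite /port_count.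
have -> : [set j | set_port f i y j == y] = i |: [set j | f j == y].
  by apply/setP => j; rewrite !inE ffunE; case: (j =P i) => // _; rewrite eqxx.
by rewrite cardsU1 inE fiy.
Qed.

(** Writing y at port i is a bijection between the two index sets; writing x back inverts it. *)
Lemma reindex_set_port (i : 'I_N) (x y : S) (phi : F -> C) :
  \sum_(f : F | f i == x) phi (set_port f i y) = \sum_(f : F | f i == y) phi f.
Proof.
rewrite [RHS](reindex_onto (fun f => set_port f i y) (fun f => set_port f i x)).
  apply: eq_bigl => f; rewrite ffunE !eqxx /=.
  apply/eqP/eqP => [fx|<-]; last by rewrite !ffunE eqxx.
  by apply/ffunP => j; rewrite !ffunE; case: eqP => // ->.
move=> f /eqP fy; apply/ffunP => j; rewrite !ffunE.
by case: eqP => // ->.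
Qed.

(** The zeros at k = -1 and k = N + 1 close the chain of counts 0, ..., N at both ends. *)
Definition port_weight (k : nat) : nat := k.+1 * (N.+1 - k).

Lemma port_weight_gt0 k : (k <= N)%N -> (0 < port_weight k)%N.
Proof. by move=> kN; rewrite muln_gt0 /= subn_gt0 ltnS. Qed.

Local Notation s := port_weight.

(* The second difference of k |-> (k + 1)(N + 1 - k) is -2. *)
Lemma port_weight_sum k : (k <= N)%N ->
  (s k.+1)%:R / (s k)%:R + (k * (N.+2 - k))%:R / (s k)%:R
    <= 2 - 2 / (N.+1 ^ 2)%:R :> C.
Proof.
move=> kN; have s0 := port_weight_gt0 kN.
have sC : (s k)%:R != 0 :> C by rewrite pnatr_eq0 -lt0n.
rewrite -mulrDl -natrD.
have -> : (s k.+1 + k * (N.+2 - k))%:R = 2 * (s k)%:R - 2 :> C.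
  have -> : (2 * (s k)%:R - 2 :> C) = (2 * s k - 2)%:R.
    by rewrite natrB ?natrM // leq_pmulr.
  congr (_%:R); rewrite /port_weight subSS; have [m ->] : exists m, N = (k + m)%N.
    by exists (N - k)%N; rewrite subnKC.
  rewrite -!addnS !addKn; nia.
rewrite mulrBl mulfK // lerD2l lerN2 ler_pM2l ?ltr0n //.
rewrite lef_pV2 ?posrE ?ltr0n ?expn_gt0 // ler_nat -mulnn leq_mul //.
exact: leq_subr.
Qed.

Variables (G : 'I_N -> S * F -> S * F -> C) (r : F -> C).
Hypothesis G_amgm : forall i u v t, 0 < t ->
  G i u v + G i v u <= t * G i u u + t^-1 * G i v v.
Hypothesis G_ge0 : forall i u, 0 <= G i u u.
Hypothesis G_sum : forall x f, \sum_i G i (x, f) (x, f) = r f.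
Hypothesis r_sum : \sum_f r f = 1.

(** A string with k ports at y is charged [p k] as the source of a step and [q k] as its target.
    Summing over i turns the charges into [(p k + q k) * r f], and [r] has total mass 1. *)
Lemma port_sum_le x y : x != y ->
  \sum_i \sum_(f : F | f i == x)
      (G i (x, f) (y, set_port f i y) + G i (y, set_port f i y) (x, f))
    <= 2 - 2 / (N.+1 ^ 2)%:R.
Proof.
move=> xy.
pose p k : C := (s k.+1)%:R / (s k)%:R.
(* This is s(k - 1) / s k, written so that k = 0 gives 0. Hence [q k.+1] is the inverse of [p k], as
   AM-GM requires. *)
pose q k : C := (k * (N.+2 - k))%:R / (s k)%:R.
pose k := port_count y.
have p0 j : 0 <= p j by rewrite divr_ge0.
have q0 j : 0 <= q j by rewrite divr_ge0.
pose A i f := p (k f) * G i (x, f) (x, f).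
pose B i f := q (k f) * G i (y, f) (y, f).
apply: (@le_trans _ _ (\sum_i \sum_f (A i f + B i f))).
  apply: ler_sum => i _.
  apply: (@le_trans _ _ (\sum_(f : F | f i == x)
      (A i f + B i (set_port f i y)))).
    apply: ler_sum => f /eqP fi.
    have fiy : f i != y by rewrite fi.
    have kE : k (set_port f i y) = (k f).+1 by exact: port_count_set.
    (* Strictness matters: [p N] is 0 and could not serve as an AM-GM weight. *)
    have kN : (k f < N)%N by rewrite -kE port_count_le.
    have pgt : 0 < p (k f).
      by rewrite divr_gt0 // ltr0n port_weight_gt0 // ltnW.
    rewrite /A /B kE; apply: le_trans (G_amgm _ _ _ pgt) _.
    by rewrite /p invf_div /q.
  rewrite !big_split /= (reindex_set_port i x y (B i)).
  (* Diagonal terms are nonnegative, so both sums may be extended to all strings. *)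
  apply: lerD.
    by rewrite [leRHS](bigID (fun f : F => f i == x)) /= lerDl sumr_ge0 // => f _;
      rewrite mulr_ge0.
  by rewrite [leRHS](bigID (fun f : F => f i == y)) /= lerDl sumr_ge0 // => f _;
      rewrite mulr_ge0.
rewrite exchange_big /=; set c := leRHS.
have -> : c = \sum_f c * r f by rewrite -mulr_sumr r_sum mulr1.
apply: ler_sum => f _.
rewrite big_split /= -!mulr_sumr !G_sum -mulrDl.
apply: ler_wpM2r; first by rewrite -(G_sum x) sumr_ge0.
exact: (port_weight_sum (port_count_le y f)).
Qed.

End PortSum.

(** * Entries of operators, and a lower bound on the diamond norm *)

Section OperatorEntries.
Set Implicit Arguments.
Unset Strict Implicit.
Variable R : realType.
Local Open Scope sesquilinear_scope.
Local Open Scope complex_scope.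
Local Open Scope ring_scope.
Implicit Types S T E : finType.

Lemma sum_enum_rank S (F : 'I_#|{: S}| -> R[i]) :
  \sum_k F k = \sum_(s : S) F (enum_rank s).
Proof. by rewrite (reindex enum_rank) //; apply: onW_bij; exact: enum_rank_bij. Qed.

Lemma sum_pair S T (F : S * T -> R[i]) : \sum_p F p = \sum_s \sum_t F (s, t).
Proof. by rewrite pair_bigA; apply: eq_bigr => -[]. Qed.

Lemma opentry_mul S (A B : 'Op[R]_S) x y :
  opentry (A *m B) x y = \sum_z opentry A x z * opentry B z y.
Proof. by rewrite /opentry mxE sum_enum_rank. Qed.

Lemma opentry1 S (x y : S) : opentry (1%:M : 'Op[R]_S) x y = (x == y)%:R.
Proof. by rewrite /opentry mxE (inj_eq enum_rank_inj). Qed.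

Lemma opentry_ketbra S (x y p q : S) :
  opentry (ketbra R x y) p q = ((p == x) && (q == y))%:R.
Proof. by rewrite /opentry mxE !(inj_eq enum_rank_inj). Qed.

Lemma opentry_sum S I (r : seq I) (P : pred I) (A : I -> 'Op[R]_S) x y :
  opentry (\sum_(i <- r | P i) A i) x y = \sum_(i <- r | P i) opentry (A i) x y.
Proof. by rewrite /opentry summxE. Qed.

Lemma opentry_inj S (A B : 'Op[R]_S) :
  (forall x y, opentry A x y = opentry B x y) -> A = B.
Proof.
move=> AB; apply/matrixP => i j; rewrite -(enum_valK i) -(enum_valK j).
exact: AB.
Qed.

Lemma mxtrace_opentry S (A : 'Op[R]_S) : \tr A = \sum_x opentry A x x.
Proof. exact: sum_enum_rank. Qed.

Lemma psdmx_opentry_gram S (A : 'Op[R]_S) : psdmx A ->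
  exists b : 'I_#|{: S}| -> S -> R[i],
    forall x y, opentry A x y = \sum_k (b k x)^* * b k y.
Proof.
move=> /psd_gram[B ->]; exists (fun k x => B k (enum_rank x)) => x y.
by rewrite /opentry mxE; apply: eq_bigr => k _; rewrite !mxE.
Qed.

Lemma opentry_ampliation S T (L : {linear 'Op[R]_S -> 'Op[R]_T}) E
    (A : 'Op[R]_(S * E)%type) x y e e' :
  opentry (ampliation L A) (x, e) (y, e') = opentry (L (opblock A e e')) x y.
Proof.
rewrite opentry_sum (bigD1 e) //= [X in _ + X]big1 => [|e1 e1e]; last first.
  rewrite opentry_sum big1 // => e2 _.
  by rewrite opfunE opentry_ketbra /= eq_sym (negPf e1e) mulr0.
rewrite addr0 opentry_sum (bigD1 e') //= [X in _ + X]big1 => [|e1 e1e]; last first.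
  by rewrite opfunE opentry_ketbra /= andbC eq_sym (negPf e1e) mulr0.
by rewrite addr0 opfunE opentry_ketbra /= !eqxx mulr1.
Qed.

(* The input is the entangled state (|xx> + |yy>)/sqrt 2; the (xx, yy) entry of
   the output is half the entry on the left. *)
Lemma coherence_le_diamond_norm S (L : {linear 'Op[R]_S -> 'Op[R]_S}) (x y : S) (eps : R) :
    x != y -> (diamond_norm L <= eps%:E)%E ->
  `|opentry (L (ketbra R x y)) x y| <= 2 * eps%:C.
Proof.
move=> xy Leps.
pose w (p : S * S) : R[i] := ((p == (x, x)) || (p == (y, y)))%:R.
pose A : 'M[R[i]]_(1, #|{: S * S}|) := \row_k w (enum_val k).
pose rho : 'Op[R]_(S * S)%type := 2^-1 *: (A^t* *m A).
have rhoE p q : opentry rho p q = 2^-1 * (w p * w q).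
  by rewrite /opentry !mxE big_ord1 !mxE !enum_rankK rmorph_nat.
have h0 : 0 < 2^-1 :> R[i] by rewrite invr_gt0 ltr0n.
have rho_state : state rho.
  split=> [v|].
    rewrite -scalemxAr -scalemxAl mxE mulr_ge0 ?(ltW h0) //.
    exact: adjoint_mul_psd.
  rewrite mxtrace_opentry.
  under eq_bigr do rewrite rhoE.
  rewrite -mulr_sumr (bigD1 (x, x)) //= (bigD1 (y, y)) /=; last first.
    by rewrite xpair_eqE negb_and eq_sym xy.
  rewrite big1 ?addr0 => [|p /andP[px py]]; last first.
    by rewrite /w (negPf px) (negPf py) mul0r.
  by rewrite /w !eqxx orbT !mulr1 mulVf // pnatr_eq0.
have blockE : opblock rho x y = 2^-1 *: ketbra R x y.
  apply: opentry_inj => p q; rewrite opfunE rhoE.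
  have -> : opentry (2^-1 *: ketbra R x y) p q = 2^-1 * opentry (ketbra R x y) p q.
    by rewrite /opentry mxE.
  rewrite opentry_ketbra /w !xpair_eqE !eqxx !andbT.
  by rewrite [y == x]eq_sym (negPf xy) !andbF orbF -natrM mulnb.
have : trace_norm (ampliation L rho) <= eps.
  rewrite -lee_fin; apply: le_trans Leps; apply: ereal_sup_ubound.
  by exists S, rho.
rewrite -lecR => h; have := le_trans (norm_entry_le_trace_norm _ _ _) h.
move=> /(_ (enum_rank (x, x)) (enum_rank (y, y))).
rewrite -/(opentry _ _ _) opentry_ampliation blockE linearZ /=.
by rewrite /opentry mxE normrM gtr0_norm // -ler_pdivlMl // invrK.
Qed.

End OperatorEntries.

(** * The Gram kernels of a PBT protocol *)

Section PortForm.
Set Implicit Arguments.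
Unset Strict Implicit.
Local Open Scope complex_scope.
Local Open Scope ring_scope.
Variables (R : realType) (d N : nat) (P : pbt R d N).
Local Notation F := {ffun 'I_N -> 'I_d}.

(* For u = (x, f) and v = (y, g), this is the trace over A' of <y|E_i|x> times
   <f|rho|g>, that is, G_i(u, v). *)
Definition port_form (i : 'I_N) (u v : 'I_d * F) : R[i] :=
  \sum_a \sum_b opentry (pbt_povm P i) (v.1, a) (u.1, b)
                * opentry (pbt_res P) (b, u.2) (a, v.2).

(** The factor |x><y| fixes both indices of the input register, and the identity on the ports leaves
    the string f unchanged. *)
Lemma opentry_pbt_channel (x y : 'I_d) :
  opentry (pbt_channel P (ketbra R x y)) x y =
  \sum_i \sum_(f : F | f i == x) port_form i (x, f) (y, set_port f i y).
Proof.
rewrite opentry_sum; apply: eq_bigr => i _.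
rewrite opfunE; apply: eq_bigr => f _; rewrite -/(set_port f i y) opfunE.
rewrite sum_pair.
have entryE s a : opentry (optens (pbt_povm P i) 1%:M *m
   opassoc (optens (ketbra R x y) (pbt_res P)))
     ((s, a), f) ((s, a), set_port f i y) =
   \sum_b opentry (pbt_povm P i) (s, a) (x, b) * (s == y)%:R *
     opentry (pbt_res P) (b, f) (a, set_port f i y).
  rewrite opentry_mul !sum_pair.
  rewrite (bigD1 x) //= [X in _ + X]big1 => [|c cx]; last first.
    rewrite big1 // => b _; rewrite big1 // => g _.
    by rewrite !opfunE /= opentry_ketbra (negPf cx) mul0r mulr0.
  rewrite addr0; apply: eq_bigr => b _.
  rewrite (bigD1 f) //= big1 => [|g gf]; last first.
    by rewrite !opfunE /= opentry1 eq_sym (negPf gf) mulr0 mul0r.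
  rewrite addr0 !opfunE /= opentry1 opentry_ketbra !eqxx mulr1 /=.
  by rewrite mulrA.
rewrite (bigD1 y) //= [X in _ + X]big1 => [|s sy]; last first.
  rewrite big1 // => a _; rewrite entryE big1 // => b _.
  by rewrite (negPf sy) mulr0 mul0r.
rewrite addr0; apply: eq_bigr => a _; rewrite entryE; apply: eq_bigr => b _.
by rewrite eqxx mulr1.
Qed.

(** Gram factors of the POVM element and of the resource state multiply; the sums over b and a then
    separate into a factor in u and a conjugate factor in v. *)
Lemma port_form_gram i : exists (K : finType) (h : K -> 'I_d * F -> R[i]),
  forall u v, port_form i u v = \sum_k h k u * (h k v)^*.
Proof.
have [e eE] := psdmx_opentry_gram (pbt_povm_psd (p := P) i).
have [c cE] := psdmx_opentry_gram (proj1 (pbt_res_state P)).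
exists _, (fun kl u => \sum_b e kl.1 (u.1, b) * (c kl.2 (b, u.2))^*) => u v.
transitivity (\sum_a \sum_b \sum_k \sum_l
   (e k (u.1, b) * (c l (b, u.2))^*) * ((e k (v.1, a))^* * c l (a, v.2))).
  apply: eq_bigr => a _; apply: eq_bigr => b _; rewrite eE cE mulr_suml.
  apply: eq_bigr => k _; rewrite mulr_sumr; apply: eq_bigr => l _; ring.
under eq_bigr => a _ do under eq_bigr => b _ do rewrite pair_bigA.
under eq_bigr => a _ do rewrite exchange_big.
rewrite exchange_big; apply: eq_bigr => kl _ /=.
rewrite exchange_big mulr_suml; apply: eq_bigr => b _ /=.
rewrite rmorph_sum mulr_sumr; apply: eq_bigr => a _.
by rewrite rmorphM /= conjCK.
Qed.

Lemma port_form_conj i u v : (port_form i u v)^* = port_form i v u.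
Proof.
have [K [h hE]] := port_form_gram i.
rewrite !hE rmorph_sum; apply: eq_bigr => k _.
by rewrite rmorphM /= conjCK mulrC.
Qed.

Lemma port_form_ge0 i u : 0 <= port_form i u u.
Proof.
have [K [h hE]] := port_form_gram i.
by rewrite hE sumr_ge0 // => k _; rewrite mul_conjC_ge0.
Qed.

Lemma port_form_amgm i u v (t : R[i]) : 0 < t ->
  port_form i u v + port_form i v u
    <= t * port_form i u u + t^-1 * port_form i v v.
Proof.
move=> t0; have [K [h hE]] := port_form_gram i.
rewrite !hE !mulr_sumr -!big_split /=; apply: ler_sum => k _.
rewrite -subr_ge0.
(* Completing the square: the gap is |t h(u) - h(v)|^2 / t. *)
have -> : t * (h k u * (h k u)^*) + t^-1 * (h k v * (h k v)^*) -
   (h k u * (h k v)^* + h k v * (h k u)^*) =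
   t^-1 * ((t * h k u - h k v) * (t * h k u - h k v)^*).
  rewrite rmorphB rmorphM /= (geC0_conj (ltW t0)); field.
  exact: lt0r_neq0.
by rewrite mulr_ge0 ?mul_conjC_ge0 // invr_ge0 ltW.
Qed.

(** Completeness of the POVM replaces the sum of its elements by the identity, which forces a = b
    and removes x. *)
Lemma port_form_sum x f :
  \sum_i port_form i (x, f) (x, f) = \sum_a opentry (pbt_res P) (a, f) (a, f).
Proof.
rewrite exchange_big; apply: eq_bigr => a _ /=.
rewrite exchange_big (bigD1 a) //= [X in _ + X]big1 => [|b ba].
  by rewrite addr0 -mulr_suml -opentry_sum pbt_povm_sum opentry1 eqxx mul1r.
rewrite -mulr_suml -opentry_sum pbt_povm_sum opentry1 xpair_eqE eq_sym.
by rewrite (negPf ba) andbF mul0r.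
Qed.

Lemma port_res_trace :
  \sum_(f : F) \sum_a opentry (pbt_res P) (a, f) (a, f) = 1.
Proof.
by rewrite exchange_big -(proj2 (pbt_res_state P)) mxtrace_opentry sum_pair.
Qed.

Lemma pbt_coherence_le (x y : 'I_d) : x != y ->
  opentry (pbt_channel P (ketbra R x y)) x y +
    (opentry (pbt_channel P (ketbra R x y)) x y)^* <= 2 - 2 / (N.+1 ^ 2)%:R.
Proof.
move=> xy; rewrite opentry_pbt_channel rmorph_sum -big_split /=.
under eq_bigr => i _.
  rewrite rmorph_sum -big_split /=.
  under eq_bigr => f _ do rewrite port_form_conj.
  over.
exact: port_sum_le port_form_amgm port_form_ge0 port_form_sum port_res_trace _ _ xy.
Qed.

(** With w = 1 - z, twice the real part of w is at least 2 / (N + 1)^2 and at most 2 |w| <= 4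
    eps. *)
Lemma pbt_error_ge (eps : R) : (1 < d)%N -> pbt_error P eps ->
  (2 * (N.+1 ^ 2)%:R)^-1 <= eps.
Proof.
move=> d1 Peps.
pose x : 'I_d := Ordinal (ltnW d1); pose y : 'I_d := Ordinal d1.
have xy : x != y by [].
have := coherence_le_diamond_norm xy Peps.
have -> : opentry ((pbt_channel P \- idfun) (ketbra R x y)) x y =
    opentry (pbt_channel P (ketbra R x y)) x y - 1.
  rewrite [LHS]mxE [X in _ + X]mxE; congr (_ - _).
  by rewrite -/(opentry _ _ _) opentry_ketbra !eqxx.
have := pbt_coherence_le xy; set z := opentry _ _ _ => zle nle.
have wE : 1 - z + (1 - z)^* = 2 - (z + z^*) by rewrite rmorphB /= conjC1; ring.
have wge : 2 / (N.+1 ^ 2)%:R <= 1 - z + (1 - z)^* by rewrite wE lerBrDr addrC -lerBrDr.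
have w0 : 0 <= 1 - z + (1 - z)^* by apply: le_trans wge; rewrite divr_ge0.
have wle : 1 - z + (1 - z)^* <= 2 * (2 * eps%:C).
  rewrite -(ger0_norm w0); apply: le_trans (ler_normD _ _) _.
  by rewrite norm_conjC distrC -mulr2n -[leLHS]mulr_natl ler_wpM2l.
rewrite -lecR fmorphV rmorphM !rmorph_nat.
rewrite -(ler_pM2l (_ : 0 < 2 * 2 :> R[i])) ?mulr_gt0 ?ltr0n // -mulrA.
have -> : 2 * (2 / (2 * (N.+1 ^ 2)%:R)) = 2 / (N.+1 ^ 2)%:R :> R[i].
  by congr (_ * _); rewrite invfM mulVKf // pnatr_eq0.
by rewrite -mulrA; exact: le_trans wge wle.
Qed.

End PortForm.

(** * From the quadratic bound on the error to the logarithmic bound on N *)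

Theorem theorem4p57 (R : realType) (d N : nat) (P : pbt R d N) (eps : R) :
  (1 < d)%N ->
  0 < eps ->
  let delta1 := 2 * (Num.sqrt (2 * eps) + 7 * eps
                     + 2 * Num.sqrt 2 * eps `^ (3 / 2) + 3 * eps ^+ 2) in
  let delta2 := 2 * eps + eps ^+ 2 in
  8 * delta1 + delta2 < 1 / 2 ->
  pbt_error P eps ->
  1 / 2 * (log2 (1 / (4 * delta1 + delta2)) - 1) <= N%:R.
Proof.
move=> d1 eps0 delta1 delta2 _ Peps.
have epsN := pbt_error_ge d1 Peps.
set w := 4 * delta1 + delta2.
have Npos : 0 < N.+1%:R :> R by rewrite ltr0n.
have sqrtN : N.+1%:R^-1 <= Num.sqrt (2 * eps).
  rewrite -(ger0_norm (_ : 0 <= N.+1%:R^-1)) ?invr_ge0 ?ler0n // -sqrtr_sqr.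
  apply: ler_wsqrtr; rewrite -ler_pdivrMl ?ltr0n //.
  by rewrite exprVn -natrX -invfM.
(* All terms of w are nonnegative, and one of them is 8 sqrt(2 eps). *)
have wN : N.+1%:R^-1 <= w.
  have e2 : 0 <= eps ^+ 2 by rewrite sqr_ge0.
  have ep : 0 <= 2 * Num.sqrt 2 * eps `^ (3 / 2).
    by rewrite mulr_ge0 ?powR_ge0 // mulr_ge0 ?sqrtr_ge0.
  apply: le_trans sqrtN _; move: (sqrtr_ge0 (2 * eps)) ep e2.
  rewrite /w /delta1 /delta2; set a := Num.sqrt (2 * eps).
  by set b := 2 * _ * _; set c := eps ^+ 2; lra.
have w0 : 0 < w by apply: lt_le_trans wN; rewrite invr_gt0.
have ln20 : 0 < ln 2 :> R by rewrite ln_gt0 // ltr1n.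
(* The goal rearranged; it follows from 1 / w <= N + 1 <= 2^N <= 2^(2N + 1). *)
have : log2 (1 / w) <= N.*2.+1%:R.
  rewrite /log2 ler_pdivrMr // mulr_natl -lnXn ?ltr0n //.
  rewrite ler_ln ?posrE ?exprn_gt0 ?ltr0n ?divr_gt0 // div1r.
  apply: (@le_trans _ _ N.+1%:R); first by rewrite -[leRHS]invrK lef_pV2 ?posrE ?invr_gt0.
  rewrite -natrX ler_nat; apply: leq_trans (ltn_expl N (ltnSn 1)) _.
  by rewrite leq_exp2l // leqW // -addnn leq_addr.
rewrite -muln2 mulnC -addn1 natrD natrM; lra.
Qed.
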